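(* Let $d\geq 1$ be an integer. There exists a real constant $c_d$, depending only on $d$, such that for every nonempty open bounded subset $U$ of $\mathbf{R}^d$, $$\int_U\int_U\log\|x-y\|\,dx\,dy\geq m(U)^2\left(c_d+\log m(U)\right),$$ where $m(U)$ is the Lebesgue measure of $U$.
   Context: For $x=(x_1,\ldots,x_d)\in\mathbf{R}^d$, write $\|x\|=\prod_{i=1}^d|x_i|$ (this is not a norm). Logarithms are natural. *)

(* Defs.v *)
From HB Require Import structures.
From mathcomp Require Import all_boot all_order all_algebra.
From mathcomp Require Import all_classical all_reals all_analysis.

Set Implicit Arguments.
Unset Strict Implicit.
Unset Printing Implicit Defensive.
Import Order.TTheory GRing.Theory Num.Theory.
Import numFieldNormedType.Exports.

Local Open Scope classical_set_scope.
Local Open Scope ring_scope.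

Fact rV_display : measure_display. Proof. by []. Qed.

(* The sigma-algebra on R^n generated by the coordinates, as the library does
   for tuples; it contains the open sets (open_measurable_rV), so it is the
   Borel sigma-algebra. *)
Section measurable_rV.
Context (R : realType) (n : nat).

Definition rV_coor (i : 'I_n) (x : 'rV[R]_n) : measurableTypeR R := x ord0 i.

Let rV_set0 : g_sigma_preimage rV_coor set0.
Proof. exact: sigma_algebra0. Qed.

Let rV_setC A : g_sigma_preimage rV_coor A -> g_sigma_preimage rV_coor (~` A).
Proof. exact: sigma_algebraC. Qed.

Let rV_bigcup (F : (set 'rV[R]_n)^nat) :
  (forall i, g_sigma_preimage rV_coor (F i)) ->
  g_sigma_preimage rV_coor (\bigcup_i F i).
Proof. exact: sigma_algebra_bigcup. Qed.

HB.instance Definition _ := @isMeasurable.Build rV_display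
  'rV[R]_n (g_sigma_preimage rV_coor) rV_set0 rV_setC rV_bigcup.

Lemma measurable_rV_coor (i : 'I_n) : measurable_fun [set: 'rV[R]_n] (rV_coor i).
Proof.
move=> _ Y mY; rewrite setTI; apply: sub_sigma_algebra => /=.
rewrite -bigcup_seq/=; exists i => /=; first by rewrite mem_index_enum.
by exists Y => //; rewrite setTI.
Qed.

Lemma measurable_fun_rV d (T : measurableType d) (f : T -> 'rV[R]_n) :
  (forall i, measurable_fun [set: T] (rV_coor i \o f)) ->
  measurable_fun [set: T] f.
Proof.
move=> mf _ A mA; rewrite setTI.
suff: g_sigma_preimage rV_coor `<=` [set B | measurable (f @^-1` B)] by exact.
apply: smallest_sub.
  split => /= [|B mB|F mF].
  - by rewrite preimage_set0.
  - by rewrite setTD preimage_setC; exact: measurableC.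
  - by rewrite preimage_bigcup; exact: bigcup_measurable.
rewrite -bigcup_seq => B [i _ [C mC <-]] /=.
by rewrite setTI; have := mf i measurableT _ mC; rewrite setTI.
Qed.

Lemma measurable_rV_box (B : 'I_n -> set (measurableTypeR R)) :
  (forall i, measurable (B i)) ->
  measurable [set x : 'rV[R]_n | forall i, B i (x ord0 i)].
Proof.
move=> mB; rewrite (_ : mkset _ = \bigcap_(i in [set: 'I_n]) (rV_coor i @^-1` B i)).
  apply: fin_bigcap_measurable => [|i _]; first exact: finite_finset.
  by have := @measurable_rV_coor i measurableT _ (mB i); rewrite setTI.
by apply/seteqP; split => [x + i _|x + i]; exact.
Qed.

Lemma open_measurable_rV (U : set 'rV[R]_n) : open U -> measurable U.
Proof.
move=> oU.
pose C (p : 'rV[rat]_n * nat) := [set x : 'rV[R]_n | forall i,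
  ball (ratr (p.1 ord0 i) : R) p.2.+1%:R^-1 (x ord0 i)].
rewrite (_ : U = \bigcup_(p in [set p | C p `<=` U]) C p).
  rewrite bigcup_mkcond; apply: countable_bigcupT_measurable.
    exact: countableP.
  move=> p; case: ifPn => _; last exact: measurable0.
  apply: (@measurable_rV_box
    (fun i => ball (ratr (p.1 ord0 i) : R) p.2.+1%:R^-1 : set R)) => i.
  by apply: measurable_realfun.open_measurable; exact: ball_open.
apply/seteqP; split => [x Ux|x [p /= pU]]; last exact: pU.
have /nbhs_ballP[e /= e0 xeU] : nbhs x U by exact: open_nbhs_nbhs.
have [k ke] : exists k, k.+1%:R^-1 < e / 2.
  have := near_infty_natSinv_lt (PosNum (divr_gt0 e0 (ltr0n R 2))) => -[k _ /(_ k)].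
  by move=> /(_ (leqnn k)) /= h; exists k.
have /all_sig[q xq] (i : 'I_n) :
    {q : rat | ball (ratr q : R) k.+1%:R^-1 (x ord0 i)}.
  apply/cid; have k0 : 0 < (k.+1%:R^-1 : R) by rewrite invr_gt0 ltr0n.
  have /rat_in_itvoo[q] : x ord0 i < x ord0 i + k.+1%:R^-1 by rewrite ltrDl.
  rewrite inE /= => /andP[xq qx]; exists q.
  by rewrite /ball /= gtr0_norm ?subr_gt0// ltrBlDl.
exists (\row_i q i, k) => /=; last by move=> i; rewrite mxE; exact: xq.
move=> y yC; apply: xeU; split => // i j; rewrite [i]ord1.
rewrite [e]splitr; apply: (@ball_triangle R R (ratr (q j))).
  by apply: ball_sym; apply: (le_ball (ltW ke)); exact: xq.
by apply: (le_ball (ltW ke)); have := yC j; rewrite mxE.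
Qed.

End measurable_rV.

Section rV_cons.
Context (R : realType) (n : nat).

Definition rV_cons (p : measurableTypeR R * 'rV[R]_n) : 'rV[R]_n.+1 :=
  row_mx (const_mx p.1 : 'rV[R]_1) p.2.

Lemma rV_cons0 p : rV_cons p ord0 ord0 = p.1.
Proof.
transitivity ((const_mx p.1 : 'rV[R]_1) ord0 ord0); last by rewrite mxE.
rewrite -[RHS](row_mxEl _ p.2) /rV_cons.
by congr (fun_of_matrix _ _ _); exact/val_inj.
Qed.

Lemma rV_consS p (i : 'I_n) : rV_cons p ord0 (lift ord0 i) = p.2 ord0 i.
Proof.
rewrite -[RHS](row_mxEr (const_mx p.1 : 'rV[R]_1)) /rV_cons.
by congr (fun_of_matrix _ _ _); exact/val_inj.
Qed.

Lemma measurable_rV_cons : measurable_fun [set: _] rV_cons.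
Proof.
apply: measurable_fun_rV => i; have [j ->|->] := unliftP ord0 i.
- rewrite (_ : _ \o _ = rV_coor j \o snd); last first.
    by apply/funext => p /=; rewrite /rV_coor rV_consS.
  by apply: measurableT_comp => //; exact: measurable_rV_coor.
- rewrite (_ : _ \o _ = fst) //.
  by apply/funext => p /=; rewrite /rV_coor rV_cons0.
Qed.

End rV_cons.

Section lebesgue_rV_succ.
Local Open Scope ereal_scope.
Context (R : realType) (n : nat).
Variable mu : {sigma_finite_measure set 'rV[R]_n -> \bar R}.

Definition lebesgue_rV_succ : set 'rV[R]_n.+1 -> \bar R :=
  pushforward (@lebesgue_measure R \x mu) (@rV_cons R n).

Let succ0 : lebesgue_rV_succ set0 = 0.
Proof. by rewrite /lebesgue_rV_succ /pushforward preimage_set0 measure0. Qed.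

Let succ_ge0 A : 0 <= lebesgue_rV_succ A.
Proof. by rewrite /lebesgue_rV_succ /pushforward; exact: measure_ge0. Qed.

Let succ_sigma_additive : semi_sigma_additive lebesgue_rV_succ.
Proof.
have mc (A : set 'rV[R]_n.+1) : measurable A -> measurable (@rV_cons R n @^-1` A).
  by move=> mA; have := @measurable_rV_cons R n measurableT _ mA; rewrite setTI.
move=> F mF tF mUF; rewrite /lebesgue_rV_succ /pushforward preimage_bigcup.
apply: measure_semi_sigma_additive.
- by move=> k; exact: mc.
- apply/trivIsetP => i j _ _ ij; rewrite -preimage_setI.
  by move/trivIsetP : tF => /(_ i j Logic.I Logic.I ij) ->; rewrite preimage_set0.
- by rewrite -preimage_bigcup; exact: mc.
Qed.

HB.instance Definition _ := isMeasure.Build _ _ _ lebesgue_rV_succ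
  succ0 succ_ge0 succ_sigma_additive.

Let succ_sigma_finite : sigma_finite setT lebesgue_rV_succ.
Proof.
have [F TF Foo] : sigma_finite setT (@lebesgue_measure R \x mu).
  have /sigma_finiteP[F [TF ndF Foo]] := sigma_finiteT (@lebesgue_measure R).
  have /sigma_finiteP[G [TG ndG Goo]] := sigma_finiteT mu.
  exists (fun k => F k `*` G k).
    rewrite -setXTT TF TG; apply/seteqP; split => [[x y]|[x y] [k _ [Fx Gy]]].
      move=> [/= [i _ Fx] [j _ Gy]]; exists (maxn i j) => //; split.
      - by move: x Fx; exact/subsetPset/ndF/leq_maxl.
      - by move: y Gy; exact/subsetPset/ndG/leq_maxr.
    by split; exists k.
  move=> k; have [mF Fk] := Foo k; have [mG Gk] := Goo k.
  split; first exact: measurableX.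
  by rewrite product_measure1E// lte_mul_pinfty// ge0_fin_numE.
pose tl (x : 'rV[R]_n.+1) : measurableTypeR R * 'rV[R]_n :=
  (x ord0 ord0, \row_i x ord0 (lift ord0 i))%R.
have tlK : cancel (@rV_cons R n) tl.
  move=> [a v]; rewrite /tl rV_cons0; congr pair.
  by apply/rowP => i; rewrite mxE rV_consS.
have mtl : measurable_fun [set: _] tl.
  apply/measurable_fun_pairP; split; first exact: (@measurable_rV_coor R n.+1).
  apply: measurable_fun_rV => i.
  rewrite (_ : _ \o _ = rV_coor (lift ord0 i)); first exact: measurable_rV_coor.
  by apply/funext => x; rewrite /= /rV_coor mxE.
exists (fun k => tl @^-1` F k); first by rewrite -preimage_bigcup -TF preimage_setT.
move=> k; have [mF Fk] := Foo k; split.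
  by have := mtl measurableT _ mF; rewrite setTI.
rewrite /lebesgue_rV_succ /pushforward -comp_preimage.
by rewrite (_ : _ \o _ = id) ?preimage_id//; apply/funext => p /=; rewrite tlK.
Qed.

HB.instance Definition _ := Measure_isSigmaFinite.Build _ _ _ lebesgue_rV_succ
  succ_sigma_finite.

End lebesgue_rV_succ.

(* Lebesgue measure on R^n (restricted to Borel sets), as the n-fold product of
   the one-dimensional one. *)
Fixpoint lebesgue_rV (R : realType) (n : nat) :
    {sigma_finite_measure set 'rV[R]_n -> \bar R} :=
  if n is n'.+1 then lebesgue_rV_succ (lebesgue_rV R n')
  else \d_(0 : 'rV[R]_0).

Lemma lebesgue_rV_box (R : realType) (n : nat)
    (B : 'I_n -> set (measurableTypeR R)) :
  (forall i, measurable (B i)) ->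
  lebesgue_rV R n [set x : 'rV[R]_n | forall i, B i (x ord0 i)] =
  (\big[mule/1]_(i < n) (@lebesgue_measure R) (B i))%E.
Proof.
elim: n B => [|n IH] B mB; first by rewrite big_ord0 /= diracE mem_set// => -[].
rewrite big_ord_recl /= -(IH (fun i => B (lift ord0 i)))// -product_measure1E//.
  rewrite /lebesgue_rV_succ /pushforward; congr (product_measure1 _ _ _).
  apply/seteqP; split => -[a v] /=.
    move=> h; split => [|i].
      by have := h ord0; rewrite rV_cons0.
    by have := h (lift ord0 i); rewrite rV_consS.
  move=> [Ba Bv] i; have [j ->|->] := unliftP ord0 i; first by rewrite rV_consS.
  by rewrite rV_cons0.
exact: (measurable_rV_box (B := fun i => B (lift ord0 i))).
Qed.

Definition absprod (R : realType) (n : nat) (x : 'rV[R]_n) : R :=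
  \prod_(i < n) `|x ord0 i|.

(* Main.v *)
Require Import Defs.
From mathcomp Require Import all_boot all_order all_algebra.
From mathcomp Require Import all_classical all_reals all_analysis.
From mathcomp Require Import measurable_realfun ring lra.
Import Order.TTheory GRing.Theory Num.Theory.
Import numFieldNormedType.Exports.
Local Open Scope classical_set_scope.
Local Open Scope ring_scope.

(** The inequality combines two facts about the uniform probability on [U],
    whose entropy is [ln (m U)]: entropy is subadditive over the coordinates,
    and on the line the logarithmic energy dominates the entropy up to an
    additive constant (a logarithmic Hardy-Littlewood-Sobolev inequality).
    Entropy never appears explicitly; both facts are used in dual form, through
    trial densities.

    One coordinate ([log_energy_minorant]).  Let [mu] be the law of a coordinate
    on [U], normalised to mass 1.  It suffices to find a positive [g] on the
    line with [int g <= C], [C] absolute, and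
    [iint ln |x - y| dmu dmu >= - int ln g dmu].  Choose a scale [r] at which
    every interval of half-length [r] has mass at most 3/4, while some interval
    [I] of half-length [2 r] has mass at least 3/4; after an affine change of
    variable [r = 1] and [I] is centred at 0.  Splitting the logarithm into its
    positive and negative parts, [ln |x - y|] is at least
    [- ln^- |x - y|], plus [ln^+ (|x| / 4)] if [y] is in [I], plus
    [ln^+ (|y| / 4)] if [x] is in [I] ([ln_dist_ge]).  A far point thus collects
    its interaction with [I] twice, and integration gives a lower bound by
    [int (- A + 3/2 ln^+ (|x| / 4)) dmu] with
    [A x = int ln^- |x - y| dmu y].  The factor 3/2 exceeds 1, hence
    [exp (- 3/2 ln^+ (|x| / 4))] is integrable at infinity.  The mass near any
    point is at most 3/4 < 1, hence by convexity [exp (A x)] is at most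
    [e + 4/3 int_(|x - y| < 1) |x - y|^(-3/4) dmu y], whose kernel is integrable
    at 0.  The product of these two functions is the trial density [g].

    All coordinates.  Put [G x = prod_i g_i x_i].  By Tonelli
    ([integral_lebesgue_rV_prod]) [int G <= C^d], and by Jensen
    ([Rintegral_ln_le]) the mean over [U] of [ln G] is at most
    [ln (C^d / m U)].  Summing the one-coordinate inequalities bounds the mean
    of [ln |prod_i (x_i - y_i)|] below by [ln (m U) - d ln C]. *)

(** * Sublevel sets and integrable functions *)

Section sublevel_sets.
Context d (T : measurableType d) (R : realType).
Variables (f : T -> R) (a : R).
Hypothesis mf : measurable_fun setT f.

Lemma measurable_sublevel : measurable [set x | f x < a].
Proof.
have := mf measurableT _ (measurable_itv `]-oo, a[); rewrite setTI.
by congr measurable; apply/seteqP; split => x /=; rewrite in_itv.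
Qed.

Lemma measurable_weak_sublevel : measurable [set x | f x <= a].
Proof.
have := mf measurableT _ (measurable_itv `]-oo, a]); rewrite setTI.
by congr measurable; apply/seteqP; split => x /=; rewrite in_itv.
Qed.

End sublevel_sets.

Lemma measurable_dist d (T : measurableType d) (R : realType) (f : T -> R)
    (a : R) :
  measurable_fun setT f -> measurable_fun setT (fun x => `|f x - a|).
Proof.
move=> mf; apply: (measurableT_comp (@normr_measurable R setT)).
exact: measurable_funB.
Qed.

Section integrable_helpers.
Context d (T : measurableType d) (R : realType).
Variables (nu : {measure set T -> \bar R}) (U : set T).
Hypothesis mU : measurable U.

Lemma integrable_bounded (f : T -> R) (B : R) : (nu U < +oo)%E ->
  measurable_fun setT f -> (forall x, U x -> `|f x| <= B) ->
  nu.-integrable U (EFin \o f).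
Proof.
move=> nuU mf fB; apply: measurable_bounded_integrable => //.
  exact: measurable_funTS.
exists B; split; first exact: num_real.
by move=> C BC x Ux; exact: (le_trans (fB x Ux) (ltW BC)).
Qed.

Lemma integrable_ge0_le (f : T -> R) (c : R) :
  measurable_fun setT f -> (forall x, 0 <= f x) ->
  (\int[nu]_(x in U) (f x)%:E <= c%:E)%E -> nu.-integrable U (EFin \o f).
Proof.
move=> mf f0 fc; apply/integrableP; split.
  by apply/measurable_EFinP; exact: measurable_funTS.
rewrite (le_lt_trans _ (ltry c))//; apply: le_trans fc; rewrite le_eqVlt.
apply/orP; left; apply/eqP; apply: eq_integral => x _ /=.
by rewrite ger0_norm.
Qed.

Lemma Rintegral_le (f : T -> R) (c : R) : (forall x, 0 <= f x) ->
  (\int[nu]_(x in U) (f x)%:E <= c%:E)%E -> \int[nu]_(x in U) f x <= c.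
Proof.
move=> f0 fc; rewrite -lee_fin fineK// ge0_fin_numE ?(le_lt_trans fc) ?ltry//.
by apply: integral_ge0 => x _; rewrite lee_fin.
Qed.

Lemma EFin_integrableD (f g : T -> R) :
  nu.-integrable U (EFin \o f) -> nu.-integrable U (EFin \o g) ->
  nu.-integrable U (EFin \o (fun x => f x + g x)).
Proof.
move=> fi gi; rewrite (_ : _ \o _ = (EFin \o f) \+ (EFin \o g))%E//.
exact: integrableD.
Qed.

Lemma EFin_integrableZl (k : R) (f : T -> R) :
  nu.-integrable U (EFin \o f) ->
  nu.-integrable U (EFin \o (fun x => k * f x)).
Proof.
move=> fi; rewrite (_ : _ \o _ = (fun x => k%:E * (EFin \o f) x))%E//.
exact: integrableZl.
Qed.

Lemma EFin_integrableZr (k : R) (f : T -> R) :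
  nu.-integrable U (EFin \o f) ->
  nu.-integrable U (EFin \o (fun x => f x * k)).
Proof.
by move=> fi; under eq_fun do rewrite mulrC; apply: EFin_integrableZl.
Qed.

Lemma EFin_integrableN (f : T -> R) :
  nu.-integrable U (EFin \o f) ->
  nu.-integrable U (EFin \o (fun x => - f x)).
Proof. by move=> fi; under eq_fun do rewrite -mulN1r; apply: EFin_integrableZl. Qed.

Section sublevel.
Variables (f : T -> R) (a : R).
Hypothesis mf : measurable_fun setT f.

Let sublevelE :
  (fun x => (f x < a)%R%:R) = \1_[set x | f x < a] :> (T -> R).
Proof.
apply/funext => x; rewrite indicE; congr (_%:R); congr nat_of_bool.
by apply/idP/idP; rewrite inE.
Qed.

Lemma measurable_fun_sublevel :
  measurable_fun setT (fun x => (f x < a)%R%:R : R).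
Proof. by rewrite sublevelE; exact/measurable_indic/measurable_sublevel. Qed.

Lemma integral_sublevel : (\int[nu]_(x in U) ((f x < a)%R%:R)%:E =
  nu (U `&` [set x | (f x < a)%R]))%E.
Proof.
rewrite setIC -integral_indic//; last exact: measurable_sublevel.
by apply: eq_integral => x _; rewrite -sublevelE.
Qed.

Lemma integrable_sublevel : (nu U < +oo)%E ->
  nu.-integrable U (EFin \o (fun x => (f x < a)%R%:R : R)).
Proof.
move=> nuU; apply: (@integrable_bounded _ 1) => //.
  exact: measurable_fun_sublevel.
by move=> x _; case: (_ < _); rewrite ?normr1 ?normr0.
Qed.

End sublevel.

End integrable_helpers.

Section finite_measure_set.
Context d (T : measurableType d) (R : realType).
Variables (mu : {measure set T -> \bar R}) (U : set T).
Hypothesis mU : measurable U.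

Lemma integrable_sumEFin (n : nat) (f : 'I_n -> T -> R) :
  (forall i, mu.-integrable U (EFin \o f i)) ->
  mu.-integrable U (fun x => (\sum_(i < n) f i x)%:E).
Proof.
move=> fi; under eq_fun do rewrite -sumEFin.
by apply: integrable_sum => // i _; exact: fi.
Qed.

Lemma Rintegral_sum (n : nat) (f : 'I_n -> T -> R) :
  (forall i, mu.-integrable U (EFin \o f i)) ->
  \int[mu]_(x in U) (\sum_(i < n) f i x) =
  \sum_(i < n) \int[mu]_(x in U) f i x.
Proof.
move=> fi; apply: EFin_inj; rewrite -sumEFin fineK; last first.
  by apply: integrable_fin_num => //; exact: integrable_sumEFin.
under eq_integral do rewrite -sumEFin.
rewrite integral_sum//; apply: eq_bigr => i _.
by rewrite fineK//; apply: integrable_fin_num => //; exact: fi.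
Qed.

(** Jensen's inequality for the logarithm, by integrating the tangent line of
    [ln] at [a / M]. *)
Lemma Rintegral_ln_le (G : T -> R) (M a : R) :
  0 < M -> mu U = M%:E -> 0 < a ->
  measurable_fun setT G -> (forall x, 0 < G x) ->
  mu.-integrable U (fun x => (ln (G x))%:E) ->
  (\int[mu]_(x in U) (G x)%:E <= a%:E)%E ->
  \int[mu]_(x in U) ln (G x) <= M * ln (a / M).
Proof.
move=> M0 muU a0 mG G0 ilnG Ga.
have aM0 : 0 < a / M by rewrite divr_gt0.
have muUoo : (mu U < +oo)%E by rewrite muU ltry.
have iG : mu.-integrable U (EFin \o G).
  by apply: integrable_ge0_le Ga => // x; exact: ltW.
have iGk : mu.-integrable U (EFin \o (fun x => M / a * G x)).
  exact: EFin_integrableZl.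
have icst : mu.-integrable U (EFin \o (fun=> ln (a / M) - 1)).
  by apply: (integrable_bounded _ _ _ _ _ mU _ `|ln (a / M) - 1|).
apply: (@le_trans _ _ (\int[mu]_(x in U) (M / a * G x + (ln (a / M) - 1)))).
  apply: le_Rintegral => //; first exact: EFin_integrableD.
  move=> x _; have := expR_ge1Dx (ln (G x) - ln (a / M)).
  rewrite expRD expRN !lnK ?posrE// invf_div mulrC; lra.
rewrite RintegralD// RintegralZl// Rintegral_cst// (_ : mu U = M%:E)//=.
have := Rintegral_le _ _ _ _ _ G a (fun x => ltW (G0 x)) Ga => Ga'.
have Ma : M / a * \int[mu]_(x in U) G x <= M.
  apply: (@le_trans _ _ (M / a * a)).
    by rewrite ler_wpM2l// divr_ge0// ltW.
  by rewrite divfK// lt0r_neq0.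
by move: Ma; lra.
Qed.

End finite_measure_set.

Section lower_integral.
Local Open Scope ereal_scope.
Context d (T : measurableType d) (R : realType).
Variables (mu : {measure set T -> \bar R}) (D : set T).

(** The integrals of the positive and negative parts are suprema over the simple
    functions below them, hence monotone without any measurability.  This is
    convenient for an iterated integral whose inner integral may be infinite. *)
Lemma le_integral_nonmeasurable (g f : T -> \bar R) :
  (forall x, D x -> g x <= f x) ->
  \int[mu]_(x in D) g x <= \int[mu]_(x in D) f x.
Proof.
move=> gf; rewrite /integral; set g' := g \_ D; set f' := f \_ D.
have gf' x : g' x <= f' x.
  by rewrite /g' /f' !patchE; case: ifPn => // /set_mem; exact: gf.
apply: leeB; apply: le_ereal_sup => _ [h hu <-]; exists h => // x;
  apply: le_trans (hu x) _.
- by apply: (@funepos_le _ _ setT) => [y _|]; [exact: gf'|rewrite in_setT].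
- by apply: (@funeneg_le _ _ setT) => [y _|]; [exact: gf'|rewrite in_setT].
Qed.

Lemma ae_le_integral_integrable (N : set T) (g f : T -> \bar R) :
  measurable D -> measurable N -> mu N = 0 ->
  mu.-integrable D g -> measurable_fun D f ->
  (forall x, D x -> ~ N x -> g x <= f x) ->
  \int[mu]_(x in D) g x <= \int[mu]_(x in D) f x.
Proof.
move=> mD mN N0 ig mf gf.
have mg : measurable_fun D g by exact: measurable_int ig.
have aegf (P : T -> Prop) : (forall x, D x -> ~ N x -> P x) ->
    {ae mu, forall x, D x -> P x}.
  move=> h; exists N; split => // x /= /not_implyP[Dx nP].
  by apply: contrapT => Nx; apply: nP; exact: h.
rewrite [leLHS]integralE [leRHS]integralE; apply: leeB.
- apply: ae_ge0_le_integral => //.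
  + exact: measurable_funepos.
  + exact: measurable_funepos.
  + apply: aegf => x Dx Nx; apply: (@funepos_le _ _ [set x]) => [y|]; rewrite inE//.
    by move=> ->; exact: gf.
- apply: ae_ge0_le_integral => //.
  + exact: measurable_funeneg.
  + exact: measurable_funeneg.
  + apply: aegf => x Dx Nx; apply: (@funeneg_le _ _ [set x]) => [y|]; rewrite inE//.
    by move=> ->; exact: gf.
Qed.

End lower_integral.

(** * Truncated logarithms and their kernels *)

Lemma exists_expn_gt (R : realType) (b : nat) (x : R) :
  (1 < b)%N -> exists k, x < b%:R ^+ k.
Proof.
move=> b1; exists (Num.bound `|x|); rewrite (le_lt_trans (ler_norm _))//.
rewrite (lt_le_trans (archi_boundP _))// -natrX ler_nat.
exact/ltnW/ltn_expl.
Qed.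

(** Integrals of truncated power functions are needed at every scale, along an
    arbitrary measurable function [V], and only up to a constant factor.  A
    majorant that is constant on dyadic shells reduces them to a geometric
    series, given that [V] has a law of density at most about [D]. *)
Lemma dyadic_integral_le d (T : measurableType d) (R : realType)
    (nu : {measure set T -> \bar R}) (U : set T) (V F : T -> R) (D A : R)
    (c rho : nat -> R) :
  measurable U -> measurable_fun setT V -> measurable_fun setT F ->
  (forall x, 0 <= F x) -> 0 <= D -> 0 <= A -> (forall k, 0 <= c k) ->
  (forall k, c k * rho k <= A / 2 ^+ k.+1) ->
  (forall k, (nu (U `&` [set x | (`|V x| <= rho k)%R]) <= (D * rho k)%:E)%E) ->
  (forall x, U x -> F x = 0 \/ exists k, `|V x| <= rho k /\ F x <= c k) ->
  (\int[nu]_(x in U) (F x)%:E <= (D * A)%:E)%E.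
Proof.
move=> mU mV mF F0 D0 A0 c0 cr nuV FV.
have mE k : measurable [set x | `|V x| <= rho k].
  by apply: measurable_weak_sublevel; exact: measurableT_comp.
pose f k x : \bar R := (c k * \1_[set x | `|V x| <= rho k] x)%:E.
have f0 k x : (0 <= f k x)%E by rewrite lee_fin mulr_ge0.
have mf k : measurable_fun setT (f k).
  apply/measurable_EFinP; exact: measurable_funM.
apply: (@le_trans _ _ (\int[nu]_(x in U) \sum_(k <oo) f k x)%E).
  apply: ge0_le_integral => //=.
  - by move=> x Ux; rewrite lee_fin.
  - by apply/measurable_EFinP; exact: measurable_funTS.
  - apply: ge0_emeasurable_sum => // k _; exact: measurable_funTS.
  - move=> x Ux; have [->|[k [Vk Fk]]] := FV x Ux; first exact: nneseries_ge0.
    apply: le_trans (nneseries_lim_ge k.+1 _) => //.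
    rewrite big_nat_recr//=; apply: le_trans (leeDr _ _); last exact: sume_ge0.
    by rewrite /f lee_fin indicE mem_set// mulr1.
rewrite integral_nneseries//; last by move=> k; exact: measurable_funTS.
apply: le_trans (epsilon_trick0 xpredT (mulr_ge0 D0 A0)).
apply: lee_nneseries => [k _ _|k _]; first exact: integral_ge0.
rewrite /f; under eq_integral do rewrite EFinM.
rewrite ge0_integralZl_EFin//; last exact/measurable_EFinP/measurable_indic.
rewrite integral_indic// setIC (le_trans (lee_wpmul2l _ (nuV k)))// ?lee_fin//.
by rewrite mulrCA -mulrA natrX ler_wpM2l.
Qed.

Definition lnneg (R : realType) (u : R) : R := Num.max 0 (- ln `|u|).

(** This is [|u|^(-3/4)] on the punctured unit ball.  Written through [lnneg] it
    takes the value 1 at 0, in agreement with the convention [ln 0 = 0]. *)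
Definition near_kernel (R : realType) (u : R) : R :=
  if `|u| < 1 then expR (3 / 4 * lnneg R u) else 0.

(** This is [ln^+ (|u| / 4)]. *)
Definition far_ln (R : realType) (u : R) : R := Num.max 0 (ln (`|u| / 4)).

(** This is the minimum of 1 and [(|u| / 4)^(-3/2)]. *)
Definition far_weight (R : realType) (u : R) : R := expR (- (3 / 2) * far_ln R u).

Arguments lnneg {R} u.
Arguments near_kernel {R} u.
Arguments far_ln {R} u.
Arguments far_weight {R} u.

Section kernels.
Context {R : realType}.
Implicit Types u v s : R.

Lemma lnneg_ge0 u : 0 <= lnneg u.
Proof. by rewrite /lnneg le_max lexx. Qed.

Lemma far_ln_ge0 u : 0 <= far_ln u.
Proof. by rewrite /far_ln le_max lexx. Qed.

Lemma lnneg_far u : 1 <= `|u| -> lnneg u = 0.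
Proof.
by move=> u1; apply/max_idPl; rewrite oppr_le0 ln_ge0.
Qed.

Lemma far_ln_near u : `|u| <= 4 -> far_ln u = 0.
Proof.
by move=> u1; apply/max_idPl; rewrite ln_le0// ler_pdivrMr ?mul1r.
Qed.

Lemma lnnegN u : lnneg (- u) = lnneg u.
Proof. by rewrite /lnneg normrN. Qed.

Lemma near_kernel_ge0 u : 0 <= near_kernel u.
Proof. by rewrite /near_kernel; case: ifP => // _; exact: expR_ge0. Qed.

Lemma far_weight_le1 u : far_weight u <= 1.
Proof.
by rewrite /far_weight -expR0 ler_expR mulNr oppr_le0 mulr_ge0// far_ln_ge0.
Qed.

Lemma measurable_lnneg : measurable_fun setT (@lnneg R).
Proof.
apply: measurable_maxr => //; apply: measurable_funN.
by apply: (measurableT_comp (@measurable_ln R)); exact: normr_measurable.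
Qed.

Lemma measurable_far_ln : measurable_fun setT (@far_ln R).
Proof.
apply: measurable_maxr => //; apply: (measurableT_comp (@measurable_ln R)).
by apply: measurable_funM => //; exact: normr_measurable.
Qed.

Lemma measurable_far_weight : measurable_fun setT (@far_weight R).
Proof.
apply: measurableT_comp => //; apply: measurable_funM => //.
exact: measurable_far_ln.
Qed.

Lemma measurable_near_kernel : measurable_fun setT (@near_kernel R).
Proof.
apply: measurable_fun_ifT => //.
  apply: measurable_fun_ltr => //; exact: normr_measurable.
apply: measurableT_comp => //; apply: measurable_funM => //.
exact: measurable_lnneg.
Qed.

(** The tangent line inequality [1 + t <= exp t] at [t = 3/4 lnneg u - ln s].
    Integrated with a good choice of [s], it plays the role of Jensen's
    inequality for the part of the measure close to a given point. *)
Lemma lnneg_le_near_kernel u s : 0 < s ->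
  lnneg u <= 4 / 3 * (near_kernel u / s + (ln s - 1) * (`|u| < 1)%R%:R).
Proof.
move=> s0; rewrite /near_kernel; case: ltP => [u1|u1]; last first.
  by rewrite lnneg_far// mul0r mulr0 addr0 mulr0.
have := expR_ge1Dx (3 / 4 * lnneg u - ln s).
rewrite expRD expRN lnK ?posrE// mulr1; lra.
Qed.

(** If [|v| < 2] and [4 < |u|], then [|u - v| >= |u| / 2], so that the positive
    part of the logarithm of the distance is at least [far_ln u]; the two
    far terms are never both nonzero, because [far_ln] vanishes on the ball of
    radius 4. *)
Lemma ln_dist_ge u v :
  - lnneg (u - v) + (`|v| < 2)%R%:R * far_ln u + (`|u| < 2)%R%:R * far_ln v
    <= ln `|u - v|.
Proof.
have base : - lnneg (u - v) <= ln `|u - v|.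
  by rewrite lerNl /lnneg le_max lexx orbT.
have far (a b : R) : `|b| < 2 -> 4 < `|a| ->
    - lnneg (a - b) + far_ln a <= ln `|a - b|.
  move=> b2 a4.
  have ab : `|a| / 4 <= `|a - b|.
    by have := lerB_dist a b; have : 0 <= `|a| := normr_ge0 _; lra.
  have a1 : 1 < `|a| / 4 by lra.
  rewrite /far_ln; have /max_idPr -> : 0 <= ln (`|a| / 4) by exact/ln_ge0/ltW.
  rewrite lnneg_far; last by lra.
  by rewrite oppr0 add0r ler_ln ?posrE; lra.
have [v2|v2] := ltP `|v| 2; have [u2|u2] := ltP `|u| 2;
  rewrite ?mul1r ?mul0r ?addr0.
- by rewrite !far_ln_near ?addr0//; lra.
- have [u4|u4] := leP `|u| 4; first by rewrite far_ln_near// addr0.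
  exact: far.
- have [v4|v4] := leP `|v| 4; first by rewrite far_ln_near// addr0.
  by have := far _ _ u2 v4; rewrite -opprB lnnegN normrN.
- exact: base.
Qed.

Lemma far_weight_dyadic u :
  exists k, `|u| <= 4 * 4 ^+ k /\ far_weight u <= 8 * 8^-1 ^+ k.
Proof.
have ex : exists k, `|u| <= 4 * 4 ^+ k.
  have [k uk] := exists_expn_gt R 4 `|u| isT; exists k.
  by have : 0 <= (4 : R) ^+ k by []; lra.
case: (ex_minnP ex) => -[|k] uk mink.
  exists 0%N; split => //; rewrite expr0; have := far_weight_le1 u; lra.
exists k.+1; split => //.
have {}mink : 4 * 4 ^+ k < `|u| by rewrite ltNge; apply/negP => /mink; rewrite ltnn.
have h : ln (4 ^+ k) <= far_ln u.
  have p4 : 0 < (4 : R) ^+ k by rewrite exprn_gt0.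
  by rewrite /far_ln le_max ler_ln ?posrE//; [apply/orP; right; lra|lra].
rewrite exprS mulrA divff// mul1r /far_weight.
(* Everything is expressed in powers of 2, with [8 = exp (3 ln 2)]. *)
have e4 : (4 : R) = 2 ^+ 2 by rewrite -natrX.
have e8 : (8 : R) = expR (ln 2 *+ 3).
  by rewrite -lnXn// lnK ?posrE ?exprn_gt0// -natrX.
rewrite e8 exprVn -expRM_natl -expRN ler_expR.
have {}h : k%:R * (ln 2 * 2) <= far_ln u.
  apply: le_trans h; rewrite e4 -exprM lnXn// -[X in _ <= X]mulr_natr natrM.
  lra.
rewrite -[ln 2 *+ 3]mulr_natr; lra.
Qed.

Lemma near_kernel_dyadic u : `|u| < 1 ->
  exists k, `|u| <= 16^-1 ^+ k /\ near_kernel u <= 8 * 8 ^+ k.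
Proof.
move=> u1; have [->|u0] := eqVneq u 0.
  exists 0%N; rewrite normr0 expr0; split => //.
  rewrite /near_kernel normr0 ltr01 /lnneg normr0 ln0// oppr0 maxxx mulr0 expR0.
  by lra.
have {}u0 : 0 < `|u| by rewrite normr_gt0.
have ex : exists k, 16^-1 ^+ k.+1 < `|u|.
  have [k uk] := exists_expn_gt R 16 `|u|^-1 isT; exists k.
  rewrite exprVn -[ltRHS]invrK ltf_pV2 ?posrE ?invr_gt0 ?exprn_gt0//.
  by rewrite (lt_le_trans uk)// ler_eXn2l ?leqnSn//; lra.
case: (ex_minnP ex) => k uk mink; exists k; split.
  case: k uk mink => [|k] uk mink; first by rewrite expr0 ltW.
  by rewrite leNgt; apply/negP => /mink; rewrite ltnn.
rewrite /near_kernel u1 -exprS.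
have e16 : (16 : R) = 2 ^+ 4 by rewrite -natrX.
have e8 : (8 : R) = expR (ln 2 *+ 3).
  by rewrite -lnXn// lnK ?posrE ?exprn_gt0// -natrX.
have h : lnneg u <= k.+1%:R * (ln 2 *+ 4).
  rewrite /lnneg ge_max; apply/andP; split.
    by rewrite mulr_ge0// mulrn_wge0// ln_ge0//; lra.
  rewrite lerNl -lnXn// -e16 mulr_natl -lnXn// -lnV ?posrE ?exprn_gt0//.
  by rewrite -exprVn ler_ln ?posrE ?exprn_gt0// ?invr_gt0//; exact: ltW.
rewrite e8 -expRM_natl ler_expR.
move: h; rewrite -[ln 2 *+ 4]mulr_natr -[ln 2 *+ 3]mulr_natr; lra.
Qed.

Lemma far_weight_integral_le d (T : measurableType d)
    (nu : {measure set T -> \bar R}) (U : set T) (V : T -> R) (D : R) :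
  measurable U -> measurable_fun setT V -> 0 <= D ->
  (forall rho : R, 0 < rho ->
    (nu (U `&` [set x | (`|V x| <= rho)%R]) <= (D * rho)%:E)%E) ->
  (\int[nu]_(x in U) (far_weight (V x))%:E <= (D * 64)%:E)%E.
Proof.
move=> mU mV D0 nuV.
apply: (@dyadic_integral_le _ _ _ nu U V _ D 64
  (fun k => 8 * 8^-1 ^+ k) (fun k => 4 * 4 ^+ k)) => //.
- by apply: measurableT_comp => //; exact: measurable_far_weight.
- by move=> x; exact: expR_ge0.
- move=> k; rewrite mulrACA -exprMn.
  have -> : (8^-1 * 4 : R) = 2^-1 by lra.
  rewrite -exprVn exprS; have : 0 <= (2^-1 : R) ^+ k by rewrite exprn_ge0.
  lra.
- by move=> k; apply: nuV; rewrite mulr_gt0// exprn_gt0.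
- by move=> x Ux; right; exact: far_weight_dyadic.
Qed.

Lemma near_kernel_integral_le d (T : measurableType d)
    (nu : {measure set T -> \bar R}) (U : set T) (V : T -> R) (D : R) :
  measurable U -> measurable_fun setT V -> 0 <= D ->
  (forall rho : R, 0 < rho ->
    (nu (U `&` [set x | (`|V x| <= rho)%R]) <= (D * rho)%:E)%E) ->
  (\int[nu]_(x in U) (near_kernel (V x))%:E <= (D * 16)%:E)%E.
Proof.
move=> mU mV D0 nuV.
apply: (@dyadic_integral_le _ _ _ nu U V _ D 16
  (fun k => 8 * 8 ^+ k) (fun k => 16^-1 ^+ k)) => //.
- by apply: measurableT_comp => //; exact: measurable_near_kernel.
- by move=> x; exact: near_kernel_ge0.
- move=> k; rewrite -mulrA -exprMn.
  have -> : (8 * 16^-1 : R) = 2^-1 by lra.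
  rewrite -exprVn exprS; have : 0 <= (2^-1 : R) ^+ k by rewrite exprn_ge0.
  lra.
- by move=> k; apply: nuV; rewrite exprn_gt0// invr_gt0.
- move=> x Ux; have [V1|V1] := ltP `|V x| 1.
    by right; exact: near_kernel_dyadic.
  by left; rewrite /near_kernel ltNge V1.
Qed.

End kernels.

(** * Lebesgue measure on row vectors *)

Section lebesgue_rV_facts.
Context {R : realType}.

Lemma measurable_fun_coord (n : nat) (i : 'I_n) :
  measurable_fun setT (fun x : 'rV[R]_n => x ord0 i).
Proof. exact: measurable_rV_coor. Qed.

Lemma lebesgue_measure_itvcc (a b : R) : a <= b ->
  (@lebesgue_measure R) `[a, b] = (b - a)%:E.
Proof.
move=> ab; rewrite lebesgue_measure_itv/= lte_fin.
have [//|ba] := ltP a b.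
have -> : a = b by apply/le_anti; rewrite ab ba.
by rewrite subrr.
Qed.

Lemma coord_le_norm (n : nat) (x : 'rV[R]_n) (i : 'I_n) :
  `|x ord0 i| <= `|x|.
Proof.
rewrite [leRHS](_ : _ = mx_norm x)// mx_normrE.
exact: (le_bigmax _ (fun ij : 'I_1 * 'I_n => `|x ij.1 ij.2|) (ord0, i)).
Qed.

Lemma lebesgue_rV_open_gt0 (n : nat) (U : set 'rV[R]_n) :
  open U -> U !=set0 -> (0 < lebesgue_rV R n U)%E.
Proof.
move=> oU [x Ux].
have /nbhs_ballP[e /= e0 xeU] : nbhs x U by exact: open_nbhs_nbhs.
pose B i : set (measurableTypeR R) := ball (x ord0 i) e.
have mB i : measurable (B i).
  by apply: measurable_realfun.open_measurable; exact: ball_open.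
apply: (@lt_le_trans _ _
    (lebesgue_rV R n [set y : 'rV[R]_n | forall i, B i (y ord0 i)])).
  rewrite lebesgue_rV_box//.
  under eq_bigr => i _ do rewrite lebesgue_measure_ball ?ltW//.
  rewrite prodEFin lte_fin; apply: prodr_gt0 => i _; by rewrite pmulrn_lgt0.
apply: le_measure; rewrite ?inE.
- exact: measurable_rV_box.
- exact: open_measurable_rV.
- by move=> y By; apply: xeU; split => // i j; rewrite [i]ord1; exact: By.
Qed.

(** A coordinate of the uniform measure on a bounded set has a bounded density:
    the slice of [U] lies in a box with sides [2 rho] and [2 L]. *)
Lemma lebesgue_rV_slab_le (n : nat) (U : set 'rV[R]_n) (L : R) (i : 'I_n) :
  measurable U -> 0 <= L -> (forall x, U x -> forall j, `|x ord0 j| <= L) ->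
  forall a rho : R, 0 <= rho ->
  (lebesgue_rV R n (U `&` [set x | (`|x ord0 i - a| <= rho)%R])
    <= ((2 * \prod_(j < n | j != i) (2 * L)) * rho)%:E)%E.
Proof.
move=> mU L0 UL a rho rho0.
pose B j : set (measurableTypeR R) :=
  [set` if j == i then `[a - rho, a + rho] else `[- L, L]].
have mB j : measurable (B j) by exact: measurable_itv.
have BE j : (@lebesgue_measure R) (B j) =
    (if j == i then 2 * rho else 2 * L)%:E.
  rewrite /B; case: ifP => _.
    rewrite lebesgue_measure_itvcc; first by congr EFin; ring.
    by rewrite lerD2l; lra.
  by rewrite lebesgue_measure_itvcc; [congr EFin; ring|lra].
apply: (@le_trans _ _
    (lebesgue_rV R n [set y : 'rV[R]_n | forall j, B j (y ord0 j)])).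
  apply: le_measure; rewrite ?inE.
  - apply: measurableI => //.
    by apply: measurable_weak_sublevel; apply: measurable_dist;
      exact: measurable_fun_coord.
  - exact: measurable_rV_box.
  - move=> x [Ux xi] j; rewrite /B; case: eqP => [->|_] /=; rewrite in_itv/=.
      by rewrite -ler_distl.
    by rewrite -ler_norml; exact: UL.
rewrite lebesgue_rV_box//; under eq_bigr => j _ do rewrite BE.
rewrite prodEFin lee_fin (bigD1 i)//= eqxx.
rewrite (eq_bigr (fun=> 2 * L)); last by move=> j /negbTE ->.
by rewrite mulrAC.
Qed.

Lemma lebesgue_rV_bounded_lty (n : nat) (U : set 'rV[R]_n) (L : R) :
  measurable U -> 0 <= L -> (forall x, U x -> forall j, `|x ord0 j| <= L) ->
  (lebesgue_rV R n U < +oo)%E.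
Proof.
move=> mU L0 UL.
pose B (j : 'I_n) : set (measurableTypeR R) := [set` `[- L, L]].
have mB j : measurable (B j) by exact: measurable_itv.
apply: (@le_lt_trans _ _
    (lebesgue_rV R n [set y : 'rV[R]_n | forall j, B j (y ord0 j)])).
  apply: le_measure; rewrite ?inE//; first exact: measurable_rV_box.
  by move=> x Ux j; rewrite /B/= in_itv/= -ler_norml; exact: UL.
rewrite lebesgue_rV_box//.
under eq_bigr => j _ do rewrite lebesgue_measure_itvcc ?ge0_cp//.
by rewrite prodEFin ltry.
Qed.

(** Tonelli's theorem, one coordinate at a time. *)
Lemma integral_lebesgue_rV_prod (n : nat) (g : 'I_n -> R -> R) :
  (forall i, measurable_fun setT (g i)) -> (forall i s, 0 <= g i s) ->
  (\int[lebesgue_rV R n]_x (\prod_(i < n) g i (x ord0 i))%:E =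
   \prod_(i < n) \int[@lebesgue_measure R]_s (g i s)%:E)%E.
Proof.
elim: n g => [|n IH] g mg g0.
  rewrite big_ord0 /= integral_dirac//; last first.
    by under eq_fun do rewrite big_ord0; exact: measurable_cst.
  by rewrite diracT big_ord0 mule1.
have mP m (h : 'I_m -> R -> R) : (forall i, measurable_fun setT (h i)) ->
    measurable_fun setT (fun x : 'rV[R]_m => \prod_(i < m) h i (x ord0 i)).
  move=> mh; apply: measurable_prod => i _.
  by apply: (measurableT_comp (mh i)); exact: measurable_fun_coord.
rewrite big_ord_recl /= -(IH (fun i => g (lift ord0 i)))//.
rewrite ge0_integral_pushforward//=; last 3 first.
- exact: measurable_rV_cons.
- by apply/measurable_EFinP; exact: mP.
- by move=> x _; rewrite lee_fin prodr_ge0.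
rewrite preimage_setT fubini_tonelli1/=; last 2 first.
- apply/measurable_EFinP.
  by apply: (measurableT_comp (mP _ _ mg)); exact: measurable_rV_cons.
- by move=> x; rewrite lee_fin prodr_ge0.
rewrite -ge0_integralZr//; last 3 first.
- exact: (measurableT_comp (f := EFin) _ (mg ord0)).
- by move=> s _; rewrite lee_fin.
- by apply: integral_ge0 => x _; rewrite lee_fin prodr_ge0.
apply: eq_integral => s _; rewrite /fubini_F /=.
rewrite -ge0_integralZl//; last 3 first.
- by apply/measurable_EFinP; exact: (mP _ (fun i => g (lift ord0 i))).
- by move=> x _; rewrite lee_fin prodr_ge0.
- by rewrite lee_fin.
apply: eq_integral => x _; rewrite big_ord_recl rV_cons0 EFinM.
by congr (_ * (_)%:E)%E; apply: eq_bigr => i _; rewrite rV_consS.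
Qed.

End lebesgue_rV_facts.

(** * Logarithmic energy at a normalised scale *)

(** In this section [Z] is a coordinate after the affine change of variable that
    brings the concentration scale to 1 and the centre of concentration to
    0.  The hypothesis [density] makes the logarithmic integrals finite. *)
Section normalised.
Context d (T : measurableType d) (R : realType).
Variables (nu : {sigma_finite_measure set T -> \bar R}) (U : set T).
Variables (Z : T -> R) (M B D : R).
Hypothesis mU : measurable U.
Hypothesis mZ : measurable_fun setT Z.
Hypothesis M0 : 0 < M.
Hypothesis nuU : nu U = M%:E.
Hypothesis ZB : forall x, U x -> `|Z x| <= B.
Hypothesis D0 : 0 <= D.
Hypothesis density : forall a rho : R, 0 < rho ->
  (nu (U `&` [set x | (`|Z x - a| <= rho)%R]) <= (D * rho)%:E)%E.
Hypothesis spread : forall a,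
  (nu (U `&` [set x | (`|a - Z x| < 1)%R]) <= (3 / 4 * M)%:E)%E.
Hypothesis core : ((3 / 4 * M)%:E <= nu (U `&` [set x | (`|Z x| < 2)%R]))%E.

(** The explicit upper bound for the exponential of the mean of
    [lnneg (z - Z y)].  The constant [expR 1] keeps [ln (smear z)] above 1, which
    the convexity argument of [lnneg_integral_le] uses. *)
Definition smear (z : R) : R :=
  expR 1 + 4 / (3 * M) * \int[nu]_(y in U) near_kernel (z - Z y).

(** The dual certificate: a function of bounded integral whose logarithm has
    mean at least minus the mean logarithmic energy. *)
Definition trial_density (z : R) : R := far_weight z * smear z.

Let nuUoo : (nu U < +oo)%E. Proof. by rewrite nuU ltry. Qed.

Let mdiff z : measurable_fun setT (fun x => z - Z x).
Proof. exact: measurable_funB. Qed.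

Let mdist z : measurable_fun setT (fun x => `|z - Z x|).
Proof. exact: (measurableT_comp (@normr_measurable R setT) (mdiff z)). Qed.

Let mnormZ : measurable_fun setT (fun x => `|Z x|).
Proof. exact: (measurableT_comp (@normr_measurable R setT) mZ). Qed.

Let mK z : measurable_fun setT (fun x => near_kernel (z - Z x)).
Proof. exact: (measurableT_comp measurable_near_kernel). Qed.

Let eK_le z : (\int[nu]_(y in U) (near_kernel (z - Z y))%:E <= (D * 16)%:E)%E.
Proof.
apply: near_kernel_integral_le => // rho rho0.
rewrite (_ : mkset _ = [set x | `|Z x - z| <= rho]); first exact: density.
by apply/seteqP; split => x /=; rewrite distrC.
Qed.

Let iK z : nu.-integrable U (fun x => (near_kernel (z - Z x))%:E).
Proof.
by apply: integrable_ge0_le (eK_le z) => // x; exact: near_kernel_ge0.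
Qed.

Lemma smear_ge z : expR 1 <= smear z.
Proof.
rewrite lerDl mulr_ge0//; first by rewrite divr_ge0// mulr_ge0// ltW.
by apply: Rintegral_ge0 => x _; exact: near_kernel_ge0.
Qed.

Lemma smear_gt0 z : 0 < smear z.
Proof. exact: lt_le_trans (expR_gt0 1) (smear_ge z). Qed.

Lemma ln_smear_ge1 z : 1 <= ln (smear z).
Proof.
by rewrite -[leLHS]expRK ler_ln ?posrE ?expR_gt0 ?smear_gt0 ?smear_ge.
Qed.

Lemma smear_le z : smear z <= expR 1 + 4 / (3 * M) * (D * 16).
Proof.
rewrite lerD2l ler_wpM2l//; first by rewrite divr_ge0// mulr_ge0// ltW.
by apply: Rintegral_le => // x; exact: near_kernel_ge0.
Qed.

(* The integrand of [smear], on the product space and with the restriction to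
   [U] made part of the function, as Tonelli's theorem wants it. *)
Let Kf (p : R * T) : \bar R := (near_kernel (p.1 - Z p.2) * \1_U p.2)%:E.

Let mKf : measurable_fun setT Kf.
Proof.
apply/measurable_EFinP; apply: measurable_funM.
  apply: (measurableT_comp measurable_near_kernel).
  by apply: measurable_funB => //; exact: measurableT_comp.
by apply: measurableT_comp => //; exact: measurable_indic.
Qed.

Let Kf_ge0 p : (0 <= Kf p)%E.
Proof. by rewrite lee_fin mulr_ge0// near_kernel_ge0. Qed.

Let KfE z :
  (\int[nu]_(y in U) (near_kernel (z - Z y))%:E)%E = fubini_F nu Kf z.
Proof.
rewrite integral_mkcond; apply: eq_integral => y _.
rewrite patchE /Kf /= indicE; case: ifPn => _; by rewrite ?mulr1 ?mulr0.
Qed.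

Lemma measurable_smear : measurable_fun setT smear.
Proof.
apply: measurable_funD => //; apply: measurable_funM => //.
rewrite /Rintegral; under eq_fun do rewrite KfE.
apply: measurableT_comp => //.
exact: (@measurable_fun_fubini_tonelli_F _ _ _ _ _ nu Kf mKf Kf_ge0).
Qed.

Let mlnneg z : measurable_fun setT (fun x => lnneg (z - Z x)).
Proof. exact: (measurableT_comp measurable_lnneg). Qed.

Lemma lnneg_integrable z : nu.-integrable U (fun x => (lnneg (z - Z x))%:E).
Proof.
have i43 : nu.-integrable U (EFin \o (fun x => 4 / 3 * near_kernel (z - Z x))).
  exact/EFin_integrableZl/iK.
apply: le_integrable i43 => //.
  by apply/measurable_EFinP; exact: measurable_funTS.
move=> x Ux /=; rewrite lee_fin ger0_norm ?lnneg_ge0// ger0_norm; last first.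
  by rewrite mulr_ge0// near_kernel_ge0.
apply: le_trans (lnneg_le_near_kernel _ 1 ltr01) _.
rewrite ln1 divr1 sub0r mulN1r ler_wpM2l//.
by rewrite lerBlDr lerDl ler0n.
Qed.

(** Convexity for the restriction of the measure to the unit ball around [z]:
    its relative mass is at most 3/4, so that the exponent 3/4 in [near_kernel]
    is enough to dominate the exponential of the integral of [lnneg]. *)
Lemma lnneg_integral_le z :
  \int[nu]_(x in U) lnneg (z - Z x) <= M * ln (smear z).
Proof.
set s := smear z; have s0 : 0 < s := smear_gt0 z.
have lns1 : 1 <= ln s := ln_smear_ge1 z.
pose near x : R := (`|z - Z x| < 1)%R%:R.
have inear : nu.-integrable U (EFin \o near).
  exact: integrable_sublevel.
have near_le : \int[nu]_(x in U) near x <= 3 / 4 * M.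
  apply: Rintegral_le; first by move=> x; rewrite ler0n.
  by rewrite integral_sublevel//; exact: spread.
have JE : \int[nu]_(x in U) near_kernel (z - Z x) = 3 / 4 * M * (s - expR 1).
  rewrite /s /smear; field; exact: lt0r_neq0.
have iKs : nu.-integrable U (EFin \o (fun x => near_kernel (z - Z x) / s)).
  exact/EFin_integrableZr/iK.
have ins : nu.-integrable U (EFin \o (fun x => (ln s - 1) * near x)).
  by apply: EFin_integrableZl.
apply: (@le_trans _ _ (\int[nu]_(x in U)
    (4 / 3 * (near_kernel (z - Z x) / s + (ln s - 1) * near x)))).
  apply: le_Rintegral => //; first exact: lnneg_integrable.
    apply: EFin_integrableZl => //.
    by apply: EFin_integrableD.
  by move=> x _; exact: lnneg_le_near_kernel.
rewrite RintegralZl//; last first.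
  by apply: EFin_integrableD.
rewrite RintegralD// (@RintegralZr _ _ _ nu U _ s^-1 mU (iK z)) JE.
rewrite (@RintegralZl _ _ _ nu U _ (ln s - 1) mU inear).
(* This is where [1 <= ln s] matters: the mass near [z] is replaced by its
   upper bound in a term with the factor [ln s - 1]. *)
apply: (@le_trans _ _ (4 / 3 * (3 / 4 * M * (s - expR 1) / s
    + (ln s - 1) * (3 / 4 * M)))).
  by rewrite ler_wpM2l// lerD2l ler_wpM2l// subr_ge0.
have -> : 4 / 3 * (3 / 4 * M * (s - expR 1) / s + (ln s - 1) * (3 / 4 * M)) =
    M * (ln s - expR 1 / s) by field; exact: lt0r_neq0.
by rewrite ler_wpM2l ?(ltW M0)// gerBl divr_ge0 ?expR_ge0 ?ltW.
Qed.

Lemma far_ln_le u : far_ln u <= `|u| :> R.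
Proof.
have u0 : 0 <= `|u| := normr_ge0 u.
rewrite /far_ln ge_max u0/=; have [->|un0] := eqVneq `|u| 0.
  by rewrite mul0r ln0.
have u40 : 0 < `|u| / 4 by rewrite divr_gt0// lt_neqAle eq_sym un0.
by apply: le_trans (ltW (ln_sublinear u40)) _; lra.
Qed.

Definition pair_minorant (x y : T) : R :=
  - lnneg (Z x - Z y) + (`|Z y| < 2)%R%:R * far_ln (Z x)
    + (`|Z x| < 2)%R%:R * far_ln (Z y).

Let Phi : R := \int[nu]_(x in U) far_ln (Z x).
Let p : R := \int[nu]_(x in U) ((`|Z x| < 2)%R%:R : R).

(** A lower bound for the integral of [pair_minorant x y] in [x], with [smear] in
    place of the integral of [lnneg]. *)
Definition inner_minorant (y : T) : R :=
  - (M * ln (smear (Z y))) + (`|Z y| < 2)%R%:R * Phi + p * far_ln (Z y).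

Let iball : nu.-integrable U (fun x => (((`|Z x| < 2)%R%:R : R))%:E).
Proof. exact: integrable_sublevel. Qed.

Let mfar : measurable_fun setT (fun x => far_ln (Z x)).
Proof. exact: (measurableT_comp measurable_far_ln). Qed.

Let ifar : nu.-integrable U (fun x => (far_ln (Z x))%:E).
Proof.
apply: (@integrable_bounded _ _ _ _ _ mU _ B) => // x Ux.
by rewrite ger0_norm ?far_ln_ge0// (le_trans (far_ln_le _))// ZB.
Qed.

Let mlnsmear : measurable_fun setT (fun x => ln (smear (Z x))).
Proof.
apply: (measurableT_comp (@measurable_ln R)).
by apply: (measurableT_comp measurable_smear).
Qed.

Let ilnsmear : nu.-integrable U (fun x => (ln (smear (Z x)))%:E).
Proof.
apply: (@integrable_bounded _ _ _ _ _ mU _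
  (ln (expR 1 + 4 / (3 * M) * (D * 16)))) => // x Ux.
rewrite ger0_norm; last exact: le_trans ler01 (ln_smear_ge1 _).
rewrite ler_ln ?posrE ?smear_gt0 ?smear_le//.
exact: lt_le_trans (smear_gt0 (Z x)) (smear_le _).
Qed.

Lemma pair_minorant_integrable y :
  nu.-integrable U (fun x => (pair_minorant x y)%:E).
Proof.
apply: (@EFin_integrableD _ _ _ _ _ mU
  (fun x => - lnneg (Z x - Z y) + (`|Z y| < 2)%R%:R * far_ln (Z x))
  (fun x => (`|Z x| < 2)%R%:R * far_ln (Z y))); last exact/EFin_integrableZr.
apply: EFin_integrableD => //; last exact/EFin_integrableZl.
apply: EFin_integrableN => //.
under eq_fun do rewrite -lnnegN opprB.
exact: lnneg_integrable.
Qed.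

Lemma inner_minorant_integrable :
  nu.-integrable U (fun y => (inner_minorant y)%:E).
Proof.
apply: (@EFin_integrableD _ _ _ _ _ mU
  (fun y => - (M * ln (smear (Z y))) + (`|Z y| < 2)%R%:R * Phi)
  (fun y => p * far_ln (Z y))); last exact/EFin_integrableZl.
apply: EFin_integrableD => //; last exact/EFin_integrableZr.
by apply: EFin_integrableN => //; exact/EFin_integrableZl.
Qed.

Lemma inner_minorant_le y :
  inner_minorant y <= \int[nu]_(x in U) pair_minorant x y.
Proof.
have i1 : nu.-integrable U (EFin \o (fun x => - lnneg (Z x - Z y))).
  under eq_fun do rewrite -lnnegN opprB.
  exact: EFin_integrableN (lnneg_integrable (Z y)).
have i2 : nu.-integrable U
    (EFin \o (fun x => (`|Z y| < 2)%R%:R * far_ln (Z x))).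
  by apply: EFin_integrableZl.
have i3 : nu.-integrable U
    (EFin \o (fun x => (`|Z x| < 2)%R%:R * far_ln (Z y))).
  by apply: EFin_integrableZr.
rewrite /pair_minorant RintegralD//; last first.
  by apply: EFin_integrableD.
rewrite RintegralD// RintegralZl// RintegralZr// !lerD2r.
rewrite (_ : Rintegral _ _ _ = - \int[nu]_(x in U) lnneg (Z y - Z x)).
  by rewrite lerN2 lnneg_integral_le.
rewrite -[RHS]mulN1r -RintegralZl//; last exact: lnneg_integrable.
by apply: eq_Rintegral => x _; rewrite mulN1r -[in RHS]lnnegN opprB.
Qed.

Lemma ln_trial_density z : ln (trial_density z) =
  - (3 / 2) * far_ln z + ln (smear z).
Proof. by rewrite lnM ?posrE ?expR_gt0 ?smear_gt0// expRK. Qed.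

Lemma ln_trial_density_integrable :
  nu.-integrable U (fun x => (ln (trial_density (Z x)))%:E).
Proof.
under eq_fun do rewrite ln_trial_density.
by apply: EFin_integrableD => //; apply: EFin_integrableZl.
Qed.

(** The two far terms of [pair_minorant] contribute equally, so that the integral
    of [far_ln] appears with the coefficient [2 p >= 3/2 M]: exactly the
    exponent of [far_weight]. *)
Lemma inner_minorant_integral_ge :
  - (M * \int[nu]_(y in U) ln (trial_density (Z y)))
    <= \int[nu]_(y in U) inner_minorant y.
Proof.
have Phi0 : 0 <= Phi by apply: Rintegral_ge0 => x _; exact: far_ln_ge0.
have pM : 3 / 4 * M <= p.
  rewrite -lee_fin fineK; last exact: integrable_fin_num.
  by rewrite integral_sublevel.
have i1 : nu.-integrable U (EFin \o (fun y => - (M * ln (smear (Z y))))).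
  by apply: EFin_integrableN => //; exact/EFin_integrableZl.
have i2 : nu.-integrable U (EFin \o (fun y => (`|Z y| < 2)%R%:R * Phi)).
  by apply: EFin_integrableZr.
have i3 : nu.-integrable U (EFin \o (fun y => p * far_ln (Z y))).
  by apply: EFin_integrableZl.
have i4 : nu.-integrable U (EFin \o (fun y => - (3 / 2) * far_ln (Z y))).
  by apply: EFin_integrableZl.
have -> : \int[nu]_(y in U) ln (trial_density (Z y)) =
    - (3 / 2) * Phi + \int[nu]_(y in U) ln (smear (Z y)).
  under eq_Rintegral do rewrite ln_trial_density.
  by rewrite RintegralD// RintegralZl.
rewrite RintegralD//; last first.
  by apply: EFin_integrableD.
rewrite RintegralD// RintegralZr// RintegralZl//.
under [X in _ <= X + _ + _]eq_Rintegral do rewrite -mulNr.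
rewrite RintegralZl//.
have := ler_wpM2r Phi0 pM; rewrite -/p -/Phi; lra.
Qed.

Lemma measurable_trial_density : measurable_fun setT trial_density.
Proof.
by apply: measurable_funM; [exact: measurable_far_weight|exact: measurable_smear].
Qed.

Lemma trial_density_gt0 z : 0 < trial_density z.
Proof. by rewrite mulr_gt0 ?expR_gt0 ?smear_gt0. Qed.

Let affine_density (c r a rho : R) : 0 < r -> 0 < rho ->
  ((@lebesgue_measure R) (setT `&`
    [set s : measurableTypeR R | (`|(s - c) / r - a| <= rho)%R])
   <= ((2 * r) * rho)%:E)%E.
Proof.
move=> r0 rho0; rewrite setTI.
rewrite (_ : mkset _ = [set` `[c + r * a - r * rho, c + r * a + r * rho]]).
  rewrite lebesgue_measure_itvcc; last first.
    by rewrite lerD2l; have := mulr_gt0 r0 rho0; lra.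
  by rewrite lee_fin; lra.
apply/seteqP; split => s /=; rewrite in_itv/= -ler_distl.
all: rewrite (_ : s - (c + r * a) = r * ((s - c) / r - a)); last first.
all: try by field; exact: lt0r_neq0.
all: by rewrite normrM gtr0_norm// ler_pM2l.
Qed.

Let measurable_affine (c r : R) : measurable_fun setT (fun s : R => (s - c) / r).
Proof. by apply: measurable_funM => //; exact: measurable_funB. Qed.

(** The bound depends on the scale [r] but neither on the measure nor on its
    density: the smearing kernel is integrated first in the variable [s], and the
    remaining integral over [U] gives the mass [M], which cancels. *)
Lemma trial_density_integral_le (c r : R) : 0 < r ->
  (\int[@lebesgue_measure R]_s (trial_density ((s - c) / r))%:E
    <= ((128 * expR 1 + 128 / 3) * r)%:E)%E.
Proof.
move=> r0; have r0' := ltW r0.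
pose w (s : measurableTypeR R) := far_weight ((s - c) / r).
pose J (s : measurableTypeR R) := fubini_F nu Kf ((s - c) / r).
have k0 : 0 <= 4 / (3 * M) by rewrite divr_ge0// mulr_ge0// ltW.
have J0 s : (0 <= J s)%E by apply: integral_ge0 => y _; exact: Kf_ge0.
have mJ : measurable_fun setT J.
  apply: (measurableT_comp
    (@measurable_fun_fubini_tonelli_F _ _ _ _ _ nu Kf mKf Kf_ge0)).
  exact: measurable_affine.
have mw : measurable_fun setT w.
  exact: (measurableT_comp measurable_far_weight (measurable_affine c r)).
have w0 s : 0 <= w s by exact: expR_ge0.
have intw : (\int[@lebesgue_measure R]_s (w s)%:E <= ((2 * r) * 64)%:E)%E.
  apply: far_weight_integral_le => //; first exact: measurable_affine.
    by rewrite mulr_ge0.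
  move=> rho rho0; have := @affine_density c r 0 rho r0 rho0.
  by under eq_set do rewrite subr0.
have intJ : (\int[@lebesgue_measure R]_s J s <= (M * ((2 * r) * 16))%:E)%E.
  pose Kr (sy : measurableTypeR R * T) := Kf ((sy.1 - c) / r, sy.2).
  have mKr : measurable_fun setT Kr.
    apply: (measurableT_comp mKf); apply/measurable_fun_pairP; split => /=.
      exact: (measurableT_comp (measurable_affine c r) measurable_fst).
    exact: measurable_snd.
  have Kr0 sy : (0 <= Kr sy)%E by exact: Kf_ge0.
  rewrite [leLHS](fubini_tonelli Kr mKr Kr0).
  apply: (@le_trans _ _ (\int[nu]_y ((2 * r * 16) * \1_U y)%:E)%E).
    apply: ge0_le_integral => //.
    - by move=> y _; apply: integral_ge0 => s _; exact: Kr0.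
    - exact: (@measurable_fun_fubini_tonelli_G _ _ _ _ _
        (@lebesgue_measure R) Kr mKr Kr0).
    - by apply/measurable_EFinP; exact: measurable_funM.
    - move=> y _; rewrite /Kr /Kf /= indicE; have [yU|yU] := boolP (y \in U).
        under eq_integral do rewrite mulr1.
        rewrite mulr1; apply: near_kernel_integral_le => //.
        + by apply: measurable_funB => //; exact: measurable_affine.
        + by rewrite mulr_ge0.
        + by move=> rho; exact: affine_density.
      under eq_integral do rewrite mulr0.
      by rewrite integral0 mulr0.
  under eq_integral do rewrite EFinM.
  rewrite ge0_integralZl_EFin//; last 2 first.
  - by apply/measurable_EFinP; exact: measurable_indic.
  - by rewrite mulr_ge0// mulr_ge0.
  rewrite integral_indic// setIT (_ : _ U = M%:E); last exact: nuU.
  by rewrite -EFinM mulrC.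
apply: (@le_trans _ _ (\int[@lebesgue_measure R]_s
    ((expR 1)%:E * (w s)%:E + (4 / (3 * M))%:E * J s))%E).
  apply: ge0_le_integral => //.
  - by move=> s _; rewrite lee_fin ltW// trial_density_gt0.
  - apply/measurable_EFinP.
    exact: (measurableT_comp measurable_trial_density (measurable_affine c r)).
  - apply: emeasurable_funD; apply: measurable_funeM => //.
    exact/measurable_EFinP.
  - move=> s _; set z := (s - c) / r.
    have JE : J s = (\int[nu]_(y in U) near_kernel (z - Z y))%:E.
      by rewrite /J -KfE fineK//; exact: integrable_fin_num.
    rewrite JE -!EFinM -EFinD lee_fin /trial_density /smear mulrDr lerD//.
      by rewrite mulrC.
    rewrite -[leRHS]mul1r ler_wpM2r ?far_weight_le1//.
    rewrite mulr_ge0//; apply: Rintegral_ge0 => x _; exact: near_kernel_ge0.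
rewrite ge0_integralD//; last 4 first.
- by move=> s _; rewrite mule_ge0 ?lee_fin ?expR_ge0.
- by apply: measurable_funeM; exact/measurable_EFinP.
- by move=> s _; rewrite mule_ge0 ?lee_fin.
- exact: measurable_funeM.
rewrite !ge0_integralZl_EFin ?expR_ge0//; last 2 first.
- by move=> s _; rewrite lee_fin.
- exact/measurable_EFinP.
apply: le_trans (leeD (lee_wpmul2l _ intw) (lee_wpmul2l _ intJ)) _.
- by rewrite lee_fin expR_ge0.
- by rewrite lee_fin.
rewrite -!EFinM -EFinD lee_fin le_eqVlt; apply/orP; left; apply/eqP.
by field; exact: lt0r_neq0.
Qed.

End normalised.

Arguments smear {d T R} nu U Z M z.
Arguments trial_density {d T R} nu U Z M z.
Arguments pair_minorant {d T R} Z x y.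
Arguments inner_minorant {d T R} nu U Z M y.

(** * Logarithmic energy of a coordinate *)

Section one_coordinate.
Context d (T : measurableType d) (R : realType).
Variables (nu : {sigma_finite_measure set T -> \bar R}) (U : set T).
Variables (X : T -> R) (M L D : R).
Hypothesis mU : measurable U.
Hypothesis mX : measurable_fun setT X.
Hypothesis M0 : 0 < M.
Hypothesis nuU : nu U = M%:E.
Hypothesis L0 : 0 < L.
Hypothesis XL : forall x, U x -> `|X x| <= L.
Hypothesis D0 : 0 <= D.
Hypothesis density : forall a rho : R, 0 <= rho ->
  (nu (U `&` [set x | (`|X x - a| <= rho)%R]) <= (D * rho)%:E)%E.

(** Among the radii [2 L / 2^k], [r] is the largest one at which no interval
    carries 3/4 of the mass.  It exists since some interval of radius [2 L]
    carries everything, while the bounded density excludes concentration at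
    small radii. *)
Lemma concentration_scale : exists c r : R, [/\ 0 < r,
  forall a : R, (nu (U `&` [set x | (`|X x - a| < r)%R]) <= (3 / 4 * M)%:E)%E &
  ((3 / 4 * M)%:E <= nu (U `&` [set x | (`|X x - c| < 2 * r)%R]))%E].
Proof.
pose heavy k := exists c : R,
  ((3 / 4 * M)%:E <= nu (U `&` [set x | (`|X x - c| < 2 * L / 2 ^+ k)%R]))%E.
have heavy0 : heavy 0%N.
  exists 0; rewrite expr0 divr1 (_ : _ `&` _ = U).
    by rewrite nuU lee_fin ler_piMl ?(ltW M0)//; lra.
  apply/seteqP; split => [x []//|x Ux]; split => //=.
  by rewrite subr0 (le_lt_trans (XL _ Ux))//; have := L0; lra.
have ex : exists k, ~~ `[< heavy k >].
  have [k kD] := exists_expn_gt R 2 (D * (2 * L) / (3 / 4 * M)) isT.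
  exists k; apply/negP => /asboolP[c].
  have p2 : 0 < (2 : R) ^+ k by rewrite exprn_gt0.
  have r0 : 0 < 2 * L / 2 ^+ k by rewrite divr_gt0// mulr_gt0.
  apply/negP; rewrite -ltNge; apply: (@le_lt_trans _ _ (D * (2 * L / 2 ^+ k))%:E).
    apply: le_trans (density c _ (ltW r0)).
    apply: le_measure; rewrite ?inE//; last by apply: setIS => x /= /ltW.
    - by apply: measurableI => //; exact/measurable_sublevel/measurable_dist.
    - by apply: measurableI => //; exact/measurable_weak_sublevel/measurable_dist.
  have M34 : 0 < 3 / 4 * M by rewrite mulr_gt0.
  by rewrite lte_fin (mulrA D) ltr_pdivrMr// [ltRHS]mulrC -ltr_pdivrMr.
case: (ex_minnP ex) => -[|k] nk mink; first by move/negP: nk; case; exact/asboolP.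
have [c hc] : heavy k.
  by apply/asboolP/negPn/negP => /mink; rewrite ltnn.
exists c, (2 * L / 2 ^+ k.+1); split.
- by rewrite divr_gt0 ?mulr_gt0// exprn_gt0.
- move=> a; rewrite leNgt; apply/negP => h; move/negP: nk; apply; apply/asboolP.
  by exists a; exact: ltW.
- rewrite exprS [2 * (_ / _)](_ : _ = 2 * L / 2 ^+ k)//.
  by field; exact: lt0r_neq0 (exprn_gt0 _ _).
Qed.

(** The one-dimensional inequality between logarithmic energy and trial
    densities.  It is stated with a pointwise minorant [f] of [ln |X x - X y|]
    and a lower bound [q] for its integral in [x], both integrable: these can be
    summed over the coordinates without discussing the integrability or
    measurability of the original double integral. *)
Lemma log_energy_minorant :
  exists (f : T -> T -> R) (q : T -> R) (g : R -> R),
  [/\ (forall x y, X x != X y -> f x y <= ln `|X x - X y|),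
      (forall y, nu.-integrable U (fun x => (f x y)%:E)),
      (forall y, q y <= \int[nu]_(x in U) f x y) &
      nu.-integrable U (fun y => (q y)%:E)] /\
  [/\ measurable_fun setT g, (forall s, 0 < g s),
      (\int[@lebesgue_measure R]_s (g s)%:E
        <= (128 * expR 1 + 128 / 3)%:E)%E,
      nu.-integrable U (fun y => (ln (g (X y)))%:E) &
      - (M * \int[nu]_(y in U) ln (g (X y))) <= \int[nu]_(y in U) q y].
Proof.
have [c [r [r0 spread core]]] := concentration_scale.
pose Z x := (X x - c) / r.
have mZ : measurable_fun setT Z.
  by apply: measurable_funM => //; exact: measurable_funB.
have rn0 : r != 0 := lt0r_neq0 r0.
have ZB x : U x -> `|Z x| <= (L + `|c|) / r.
  move=> Ux; rewrite normrM normfV (gtr0_norm r0) ler_pM2r ?invr_gt0//.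
  by rewrite (le_trans (ler_normB _ _))// lerD2r XL.
have distZ x a : `|Z x - a| = `|X x - (c + r * a)| / r.
  rewrite -{2}(gtr0_norm r0) -normfV -normrM; congr `| _ |.
  by rewrite /Z; field.
have Dr0 : 0 <= D * r by rewrite mulr_ge0// ltW.
have densZ a rho : 0 < rho ->
    (nu (U `&` [set x | (`|Z x - a| <= rho)%R]) <= (D * r * rho)%:E)%E.
  move=> rho0; rewrite -mulrA (_ : mkset _ =
      [set x | `|X x - (c + r * a)| <= r * rho]).
    by apply: density; rewrite mulr_ge0// ltW.
  by apply/seteqP; split => x /=; rewrite distZ ler_pdivrMr// [rho * r]mulrC.
have spreadZ a : (nu (U `&` [set x | (`|a - Z x| < 1)%R]) <= (3 / 4 * M)%:E)%E.
  rewrite (_ : mkset _ = [set x | `|X x - (c + r * a)| < r]); first exact: spread.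
  by apply/seteqP; split => x /=; rewrite (distrC a) distZ ltr_pdivrMr// mul1r.
have coreZ : ((3 / 4 * M)%:E <= nu (U `&` [set x | (`|Z x| < 2)%R]))%E.
  rewrite (_ : mkset _ = [set x | `|X x - c| < 2 * r])//.
  apply/seteqP; split => x /=;
    by rewrite -[Z x]subr0 distZ mulr0 addr0 ltr_pdivrMr.
pose G := trial_density nu U Z M.
have G0 z : 0 < G z by exact: trial_density_gt0.
have mG : measurable_fun setT G by exact: measurable_trial_density.
have mGaff : measurable_fun setT (fun s : R => G ((s - c) / r)).
  apply: (measurableT_comp mG); apply: measurable_funM; last exact: measurable_cst.
  exact: measurable_funB.
have iG : nu.-integrable U (EFin \o (fun y => ln (G (Z y)))).
  exact: (@ln_trial_density_integrable _ _ _ nu U Z M _ _ mU mZ M0 nuU ZB Dr0 densZ).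
have nuUoo : (nu U < +oo)%E by rewrite nuU ltry.
have cstint k : nu.-integrable U (EFin \o (fun=> k)).
  by apply: (@integrable_bounded _ _ _ _ _ mU _ `|k|) => //.
have intcst k : \int[nu]_(_ in U) k = k * M.
  by rewrite Rintegral_cst// (_ : _ U = M%:E); last exact: nuU.
have lnG x : ln (G (Z x) / r) = ln (G (Z x)) - ln r by rewrite ln_div ?posrE.
exists (fun x y => ln r + pair_minorant Z x y),
  (fun y => M * ln r + inner_minorant nu U Z M y),
  (fun s => G ((s - c) / r) / r); split; split.
- move=> x y xy; have -> : `|X x - X y| = r * `|Z x - Z y|.
    by rewrite -{1}(gtr0_norm r0) -normrM; congr `| _ |; rewrite /Z; field.
  rewrite lnM ?posrE ?normr_gt0//; last first.
    rewrite subr_eq0; apply: contra xy => /eqP xy; apply/eqP.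
    by apply: (addIr (- c)); apply: (mulIf (invr_neq0 rn0)).
  by rewrite lerD2l; exact: ln_dist_ge.
- move=> y; apply: EFin_integrableD => //.
  exact: (pair_minorant_integrable _ _ _ nu U Z M _ _ mU mZ nuU ZB Dr0 densZ).
- move=> y; rewrite RintegralD//; last first.
    exact: (pair_minorant_integrable _ _ _ nu U Z M _ _ mU mZ nuU ZB Dr0 densZ).
  rewrite intcst mulrC lerD2l.
  exact: (inner_minorant_le _ _ _ nu U Z M _ _ mU mZ M0 nuU ZB Dr0 densZ spreadZ y).
- apply: EFin_integrableD => //.
  exact: (@inner_minorant_integrable _ _ _ nu U Z M _ _ mU mZ M0 nuU ZB Dr0 densZ).
- by apply: (measurable_funM mGaff); exact: measurable_cst.
- by move=> s; rewrite divr_gt0.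
- under eq_integral do rewrite mulrC EFinM.
  rewrite ge0_integralZl_EFin//; last 3 first.
  + by move=> s _; rewrite lee_fin ltW.
  + exact/measurable_EFinP.
  + by rewrite invr_ge0 ltW.
  have h := @trial_density_integral_le _ _ _ nu U Z M _ mU mZ M0 nuU Dr0 densZ c r r0.
  apply: le_trans (lee_wpmul2l _ h) _; first by rewrite lee_fin invr_ge0 ltW.
  by rewrite -EFinM lee_fin mulrCA mulVf// mulr1.
- under eq_fun do rewrite lnG.
  by apply: EFin_integrableD => //; exact: cstint.
- under eq_Rintegral do rewrite lnG.
  rewrite RintegralB// RintegralD//; last first.
    exact: (@inner_minorant_integrable _ _ _ nu U Z M _ _ mU mZ M0 nuU ZB Dr0 densZ).
  rewrite !intcst.
  have := @inner_minorant_integral_ge _ _ _ nu U Z M _ _ mU mZ M0 nuU ZB Dr0 densZ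
    coreZ.
  by rewrite -/G; lra.
Qed.

End one_coordinate.

(** * The product of the coordinates *)

Lemma ln_prod (R : realType) (n : nat) (a : 'I_n -> R) :
  (forall i, 0 < a i) -> ln (\prod_(i < n) a i) = \sum_(i < n) ln (a i).
Proof.
move=> a0; apply: expR_inj; rewrite lnK ?posrE ?prodr_gt0//.
elim/big_ind2 : _ => [|x u y v -> ->|i _]; first by rewrite expR0.
  by rewrite expRD.
by rewrite lnK ?posrE.
Qed.

Lemma lee_prod_const (R : realType) (n : nat) (a : 'I_n -> \bar R) (C : R) :
  (forall i, 0 <= a i)%E -> (forall i, a i <= C%:E)%E ->
  (\prod_(i < n) a i <= (C ^+ n)%:E)%E.
Proof.
elim: n a => [|n IH] a a0 aC; first by rewrite big_ord0 expr0.
rewrite big_ord_recl exprS EFinM; apply: lee_pmul => //; last exact: IH.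
by apply: prode_ge0.
Qed.

Lemma measurable_absprod (R : realType) (n : nat) (y : 'rV[R]_n) :
  measurable_fun setT (fun x : 'rV[R]_n => absprod (x - y)).
Proof.
apply: measurable_prod => i _.
under eq_fun do rewrite !mxE.
by apply: measurable_dist; exact: measurable_fun_coord.
Qed.

Lemma measurable_lne_absprod (R : realType) (n : nat) (y : 'rV[R]_n) :
  measurable_fun setT (fun x : 'rV[R]_n => lne (absprod (x - y))%:E).
Proof.
rewrite (_ : (fun _ => _) = (fun x =>
    if (0 < absprod (x - y))%R then (ln (absprod (x - y)))%:E else -oo%E)).
  apply: measurable_fun_ifT => //.
    by apply: measurable_fun_ltr => //; exact: measurable_absprod.
  apply/measurable_EFinP; apply: (measurableT_comp (@measurable_ln R)).
  exact: measurable_absprod.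
apply/funext => x; case: ltP => [p0|p0]; first by rewrite lne_EFin.
by rewrite le0_lneNy// lee_fin.
Qed.

Theorem theorem5p3 (R : realType) (d : nat) (hd : (1 <= d)%N) :
  let m := lebesgue_rV R d in
  exists c : R, forall U : set 'rV[R]_d,
    U !=set0 -> open U -> bounded_set U ->
    (\int[m]_(y in U) (\int[m]_(x in U) lne (absprod (x - y))%:E)
       >= m U ^+ 2 * (c%:E + lne (m U)))%E.
Proof.
move=> m.
pose C : R := 128 * expR 1 + 128 / 3.
have C0 : 0 < C.
  by apply: addr_gt0; [rewrite mulr_gt0// expR_gt0|rewrite divr_gt0].
exists (- (d%:R * ln C)) => U U0 oU bU.
have mU : measurable U by exact: open_measurable_rV.
have [L L0 UL] : exists2 L : R, 0 < L &
    forall x, U x -> forall j, `|x ord0 j| <= L.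
  have [K [_ UK]] := bU; exists (`|K| + 1); first by rewrite ltr_wpDl.
  move=> x Ux j; apply: le_trans (coord_le_norm _ _ _) (UK _ _ _ Ux).
  by rewrite ltr_pwDr// ler_norm.
have mUoo := lebesgue_rV_bounded_lty _ _ _ mU (ltW L0) UL.
have mU0 := lebesgue_rV_open_gt0 _ _ oU U0.
pose M := fine (m U).
have mUE : m U = M%:E by rewrite fineK// ge0_fin_numE.
have M0 : 0 < M by rewrite -lte_fin -mUE.
pose Di (i : 'I_d) : R := 2 * \prod_(j < d | j != i) (2 * L).
have Di0 i : 0 <= Di i.
  by rewrite mulr_ge0// prodr_ge0// => j _; rewrite mulr_ge0// ltW.
have mX (i : 'I_d) := @measurable_fun_coord R d i.
have slab (i : 'I_d) := lebesgue_rV_slab_le _ _ _ i mU (ltW L0) UL.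
have key (i : 'I_d) := log_energy_minorant _ _ _ m U _ M L (Di i) mU (mX i)
  M0 mUE L0 (fun x Ux => UL x Ux i) (Di0 i) (slab i).
have [f /choice[q /choice[g H]]] := choice key.
pose G (x : 'rV[R]_d) := \prod_(i < d) g i (x ord0 i).
have mg i : measurable_fun setT (g i) by have [_ []] := H i.
have g0 i s : 0 < g i s by have [_ []] := H i.
have G0 x : 0 < G x by rewrite prodr_gt0.
have mG : measurable_fun setT G.
  apply: measurable_prod => i _.
  by apply: (measurableT_comp (mg i)); exact: measurable_fun_coord.
have lnG x : ln (G x) = \sum_(i < d) ln (g i (x ord0 i)) by rewrite ln_prod.
have ilng i : m.-integrable U (EFin \o (fun x => ln (g i (x ord0 i)))).
  by have [_ []] := H i.
have ilnG : m.-integrable U (fun x => (ln (G x))%:E).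
  by under eq_fun do rewrite lnG; exact: integrable_sumEFin.
have intG : (\int[m]_(x in U) (G x)%:E <= (C ^+ d)%:E)%E.
  apply: le_trans (ge0_subset_integral _ mU measurableT _ _ _) _ => //.
  - exact/measurable_EFinP.
  - by move=> x _; rewrite lee_fin ltW.
  rewrite integral_lebesgue_rV_prod//; last by move=> i s; exact: ltW.
  apply: lee_prod_const => i; last by have [_ []] := H i.
  by apply: integral_ge0 => s _; rewrite lee_fin ltW.
have Jensen : \int[m]_(x in U) ln (G x) <= M * ln (C ^+ d / M).
  by apply: Rintegral_ln_le => //; rewrite exprn_gt0.
have iq i : m.-integrable U (EFin \o q i) by have [[]] := H i.
(* Where a coordinate of [x] and [y] agree, the integrand is [-oo] and [f] is
   no minorant; these [x] lie in finitely many slabs of thickness zero. *)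
have inner y : U y ->
    ((\sum_(i < d) q i y)%:E <= \int[m]_(x in U) lne (absprod (x - y))%:E)%E.
  move=> Uy.
  have fi i : m.-integrable U (EFin \o (fun x => f i x y)).
    by have [[_ + _ _] _] := H i; exact.
  pose N (i : 'I_d) := U `&` [set x : 'rV[R]_d | `|x ord0 i - y ord0 i| <= 0].
  have [mN N0] : measurable (\big[setU/set0]_(i < d) N i) /\
      m (\big[setU/set0]_(i < d) N i) = 0%E.
    elim/big_ind : _ => [|A B [mA A0] [mB B0]|i _].
    - by split; [exact: measurable0|rewrite measure0].
    - by split; [exact: measurableU|rewrite measureU0].
    - split.
        apply: measurableI => //.
        by apply/measurable_weak_sublevel; apply: measurable_dist; exact: mX.
      apply/eqP; rewrite -measure_le0.
      by apply: le_trans (slab i _ 0 (lexx 0)) _; rewrite mulr0.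
  apply: (@le_trans _ _ (\int[m]_(x in U) (\sum_(i < d) f i x y)%:E)%E).
    rewrite -[leRHS]fineK; last first.
      by apply: integrable_fin_num => //; exact: integrable_sumEFin.
    rewrite lee_fin -/(Rintegral m U _) Rintegral_sum//.
    by apply: ler_sum => i _; have [[_ _ + _] _] := H i; exact.
  apply: (ae_le_integral_integrable _ _ _ _ _ _ _ _ mU mN N0).
  - exact: integrable_sumEFin.
  - by apply: measurable_funTS; exact: measurable_lne_absprod.
  - move=> x Ux Nx.
    have xy i : x ord0 i != y ord0 i.
      apply/eqP => xyi; apply: Nx; rewrite -bigcup_seq; exists i => /=.
        by rewrite mem_index_enum.
      by split => //=; rewrite xyi subrr normr0.
    have xy0 i : 0 < `|(x - y) ord0 i| by rewrite !mxE normr_gt0 subr_eq0.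
    rewrite lne_EFin ?prodr_gt0// lee_fin ln_prod//.
    apply: ler_sum => i _; rewrite !mxE.
    by have [[+ _ _ _] _] := H i; exact.
apply: le_trans (le_integral_nonmeasurable _ _ _ _ _ _ _ inner).
rewrite -[leRHS]fineK; last first.
  by apply: integrable_fin_num => //; exact: integrable_sumEFin.
rewrite -/(Rintegral m U _) Rintegral_sum// mUE lne_EFin// -EFinD -EFin_expe.
rewrite -EFinM lee_fin.
apply: (@le_trans _ _
    (\sum_(i < d) - (M * \int[m]_(x in U) ln (g i (x ord0 i))))).
  rewrite sumrN -mulr_sumr -Rintegral_sum//.
  under eq_Rintegral do rewrite -lnG.
  apply: (@le_trans _ _ (- (M * (M * ln (C ^+ d / M))))); last first.
    by rewrite lerN2 ler_wpM2l// ltW.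
  rewrite ln_div ?posrE ?exprn_gt0// lnXn// -mulr_natl.
  by rewrite le_eqVlt; apply/orP; left; apply/eqP; ring.
by apply: ler_sum => i _; have [_ []] := H i.
Qed.
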